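(* Let $H$ be a bipartite graph with $n$ vertices and maximum degree $d \geq 1$. If $\epsilon>0$ and $G$ is a graph with $N \geq 32d\epsilon^{-d}n$ vertices and at least $\epsilon\binom{N}{2}$ edges, then $G$ contains at least $(2^7d)^{-n/2}\epsilon^{dn}N^n$ labeled copies of $H$.
   Context: A labeled copy of $H$ in $G$ is an injective map from the vertex set of $H$ to the vertex set of $G$ that maps every edge of $H$ to an edge of $G$.
   Formalization: The formal theorem also assumes N ≥ 2; for a one-vertex G the claim is false as written (H = K_2, ε = 64, N = 1 meets every hypothesis, yet G contains no copy of H). *)

(* Defs.v *)
From mathcomp Require Import all_boot.

Set Implicit Arguments.
Unset Strict Implicit.
Unset Printing Implicit Defensive.

Record sgraph := SGraph {
  vertex :> finType;
  adj : rel vertex;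
  adj_sym : symmetric adj;
  adj_irr : irreflexive adj }.

Arguments adj {s}.

Section Graphs.
Variable G : sgraph.

Definition edges : {set {set G}} :=
  [set e : {set G} | [exists x, exists y, adj x y && (e == [set x; y])]].

Definition degree (x : G) : nat := #|[set y | adj x y]|.

Definition max_degree : nat := \max_(x : G) degree x.

Definition bipartite : Prop :=
  exists A : {set G}, forall x y : G, adj x y -> (x \in A) != (y \in A).

End Graphs.

Definition labeled_copies (H G : sgraph) : {set {ffun H -> G}} :=
  [set f : {ffun H -> G} | injectiveb f &&
    [forall x, forall y, adj x y ==> adj (f x) (f y)]].

(* Main.v *)
(** Dependent random choice followed by a greedy embedding.  Let q = eps^d N.
    If U is the common neighbourhood of a random d-tuple T of vertices, then
    |U|^d is large on average by convexity, whereas a d-tuple with fewer than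
    q / (8d) common neighbours lies in U only if T lies in its small common
    neighbourhood.  So for some T one has |U| >= q / 4 while fewer than
    (|U| / (4d))^d of the d-tuples in U are bad.  The larger side of H is embedded
    into U one vertex at a time, keeping the proportion of bad completions of
    each partially embedded neighbourhood below (4d)^(-number of missing vertices);
    at least |U| / 2 choices are available at each step.  Afterwards no
    neighbourhood is bad, and each vertex of the smaller side has at least
    q / (8d) - n >= q / (16d) choices. *)
Require Import Defs.
From mathcomp Require Import all_boot all_order all_algebra.
From mathcomp Require Import reals exp.
From mathcomp Require Import ring lra zify.
Import Order.TTheory GRing.Theory Num.Theory.
Local Open Scope ring_scope.

Set Implicit Arguments.
Unset Strict Implicit.
Unset Printing Implicit Defensive.

(** * Power inequalities *)

(** Multiplying the inductive bound by [x] leaves the nonnegative surplus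
    [d.+1 * m ^ d * (x - m) ^ 2]. *)
Lemma expr_tangent (R : realDomainType) (x m : R) (d : nat) :
  0 <= x -> 0 <= m -> m ^+ d.+1 + d.+1%:R * m ^+ d * (x - m) <= x ^+ d.+1.
Proof.
move=> x0 m0; elim: d => [|d IH]; first by rewrite expr0 !expr1; lra.
have := ler_wpM2l x0 IH; rewrite -exprS; apply: le_trans.
rewrite -subr_ge0.
suff -> : x * (m ^+ d.+1 + d.+1%:R * m ^+ d * (x - m)) -
    (m ^+ d.+2 + d.+2%:R * m ^+ d.+1 * (x - m)) =
    d.+1%:R * m ^+ d * (x - m) ^+ 2.
  by rewrite mulr_ge0 ?sqr_ge0 ?mulr_ge0 ?exprn_ge0.
by rewrite !exprS -[d.+2%:R]natr1; ring.
Qed.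

(** The tangent bounds at [m] are summed; their linear terms have a nonnegative total. Taking [m] as
    a lower bound for the mean avoids dividing by [#|I|]. *)
Lemma power_mean (R : realFieldType) (I : finType) (x : I -> R) (m : R) (d : nat) :
  (forall i, 0 <= x i) -> 0 <= m -> #|I|%:R * m <= \sum_i x i ->
  #|I|%:R * m ^+ d.+1 <= \sum_i x i ^+ d.+1.
Proof.
move=> x0 m0 mx; apply: (@le_trans _ _
  (\sum_i (m ^+ d.+1 + d.+1%:R * m ^+ d * (x i - m)))); last first.
  by apply: ler_sum => i _; apply: expr_tangent.
rewrite big_split /= sumr_const -[X in X + _]mulr_natl lerDl.
rewrite -mulr_sumr mulr_ge0 ?mulr_ge0 ?exprn_ge0 //.
by rewrite big_split /= sumr_const mulNrn -mulr_natl subr_ge0.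
Qed.

Lemma ler_exprD (R : realDomainType) (a b : R) (d : nat) :
  0 <= a -> 0 <= b -> a ^+ d.+1 + b ^+ d.+1 <= (a + b) ^+ d.+1.
Proof.
move=> a0 b0; elim: d => [|d IH]; first by rewrite !expr1.
rewrite [X in _ <= X]exprS.
have := ler_wpM2l (addr_ge0 a0 b0) IH; apply: le_trans.
rewrite [a ^+ _]exprS [b ^+ _]exprS -subr_ge0.
set u := a ^+ _; set v := b ^+ _.
have -> : (a + b) * (u + v) - (a * u + b * v) = a * v + b * u by ring.
by rewrite addr_ge0 ?mulr_ge0 ?exprn_ge0.
Qed.

(** * Counting tuples *)

Lemma big_tuple_cons (T : finType) (k : nat) (F : k.+1.-tuple T -> nat) :
  (\sum_(t : k.+1.-tuple T) F t =
   \sum_(u : T) \sum_(t : k.-tuple T) F (cons_tuple u t))%N.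
Proof.
rewrite pair_big /= (reindex (fun p : T * k.-tuple T => cons_tuple p.1 p.2)) //=.
exists (fun t => (thead t, behead_tuple t)) => [[u t] _ | t _] /=.
  by rewrite theadE; congr (_, _); apply: val_inj.
by rewrite [RHS]tuple_eta; apply: val_inj.
Qed.

Lemma sum_tuple_all (T : finType) (A : {set T}) (k : nat) :
  (\sum_(t : k.-tuple T) (all [in A] t : nat) = #|A| ^ k)%N.
Proof.
elim: k => [|k IH].
  rewrite (eq_bigr (fun=> 1%N)) => [|t _]; last by rewrite tuple0.
  by rewrite sum1_card card_tuple expn0.
rewrite big_tuple_cons expnS -IH -sum1_card big_distrl /=.
rewrite [RHS]big_mkcond; apply: eq_bigr => u _ /=.
by case: (u \in A) => /=; rewrite ?mul1n // big1.
Qed.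

(** * Greedy extension of partial maps *)

Section Greedy.
Variables (V W : finType) (f0 : {ffun V -> W}).

Definition update (f : {ffun V -> W}) (x : V) (u : W) : {ffun V -> W} :=
  [ffun y => if y == x then u else f y].

(* Fixing the values outside [D] to those of [f0] makes partial maps on [D]
   countable as elements of [{ffun V -> W}]. *)
Definition extends (Inv : {set V} -> pred {ffun V -> W}) (D : {set V}) :=
  [set f : {ffun V -> W} | Inv D f & [forall y, (y \notin D) ==> (f y == f0 y)]].

Lemma update_imset (f : {ffun V -> W}) (x : V) (u : W) (D : {set V}) :
  x \notin D -> update f x u @: D = f @: D.
Proof.
move=> xD; apply: eq_in_imset => y yD; rewrite ffunE.
by case: eqP => // yx; rewrite -yx yD in xD.
Qed.

Lemma update_imsetU (f : {ffun V -> W}) (x : V) (u : W) (D : {set V}) :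
  x \notin D -> update f x u @: (x |: D) = u |: f @: D.
Proof. by move=> xD; rewrite imsetU1 ffunE eqxx update_imset. Qed.

Lemma update_inj_in (f : {ffun V -> W}) (x : V) (u : W) (D : {set V}) :
  x \notin D -> {in D &, injective f} -> u \notin f @: D ->
  {in x |: D &, injective (update f x u)}.
Proof.
move=> xD fI uD y z; rewrite !ffunE => /setU1P[->|yD] /setU1P[->|zD] //.
- rewrite eqxx; case: eqP => // _ E.
  by rewrite E imset_f in uD.
- rewrite eqxx; case: eqP => // _ E.
  by rewrite -E imset_f in uD.
- case: eqP => [yx|_]; first by rewrite -yx yD in xD.
  case: eqP => [zx|_]; first by rewrite -zx zD in xD.
  exact: fI.
Qed.

(** Distinct pairs of a map and an admissible value give distinct updates: the value is read off at
    [x], and the old map is recovered because it agrees with [f0] at [x]. *)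
Lemma greedy_step (R : numDomainType) (Inv : {set V} -> pred {ffun V -> W})
    (D : {set V}) (x : V) (c : R) :
  x \notin D ->
  (forall f, Inv D f -> c <= #|[set u | Inv (x |: D) (update f x u)]|%:R) ->
  c * #|extends Inv D|%:R <= #|extends Inv (x |: D)|%:R.
Proof.
move=> xD step.
pose P := [set p : {ffun V -> W} * W |
  (p.1 \in extends Inv D) && Inv (x |: D) (update p.1 x p.2)].
have injP : {in P &, injective (fun p => update p.1 x p.2)}.
  move=> [f u] [g v]; rewrite !inE /=.
  move=> /andP[/andP[_ /forallP fD] _] /andP[/andP[_ /forallP gD] _] /ffunP E.
  congr (_, _); last by have := E x; rewrite !ffunE eqxx.
  apply/ffunP => y; have := E y; rewrite !ffunE; case: eqP => // -> _.
  by have /eqP -> := implyP (fD x) xD; have /eqP -> := implyP (gD x) xD.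
have subP : (fun p => update p.1 x p.2) @: P \subset extends Inv (x |: D).
  apply/subsetP => _ /imsetP[[f u] + ->]; rewrite !inE /=.
  move=> /andP[/andP[_ /forallP fD] ->] /=; apply/forallP => y; apply/implyP.
  rewrite !inE negb_or ffunE => /andP[/negPf -> yD].
  by have := fD y; rewrite yD.
have := subset_leq_card subP; rewrite card_in_imset // => leP.
apply: (@le_trans _ _ #|P|%:R); last by rewrite ler_nat.
have -> : #|P| = (\sum_(f in extends Inv D)
    #|[set u | Inv (x |: D) (update f x u)]|)%N.
  rewrite -sum1_card (eq_bigl (fun p => (p.1 \in extends Inv D) &&
    (p.2 \in [set u | Inv (x |: D) (update p.1 x u)]))); last first.
    by move=> p; rewrite !inE.
  rewrite -(pair_big_dep (fun f => f \in extends Inv D)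
    (fun f u => u \in [set u | Inv (x |: D) (update f x u)]) (fun _ _ => 1%N)) /=.
  by apply: eq_bigr => f _; rewrite sum1_card.
rewrite natr_sum mulr_natr -sumr_const; apply: ler_sum => f.
by rewrite inE => /andP[fD _]; apply: step.
Qed.

(** The bound [c] is uniform over maps and stages, so vertices may be added in any order and the
    factors multiply. *)
Lemma greedy (R : numDomainType) (Inv : {set V} -> pred {ffun V -> W})
    (D0 D1 : {set V}) (c : R) :
  0 <= c -> D0 \subset D1 ->
  (forall (D : {set V}) x f, D0 \subset D -> x |: D \subset D1 -> x \notin D -> Inv D f ->
     c <= #|[set u | Inv (x |: D) (update f x u)]|%:R) ->
  c ^+ #|D1 :\: D0| * #|extends Inv D0|%:R <= #|extends Inv D1|%:R.
Proof.
move=> c0; move Em : #|_| => m; elim: m D0 Em => [|m IH] D0 Em sD step.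
  move/cards0_eq/eqP: Em; rewrite setD_eq0 => sD'.
  have -> : D0 = D1 by apply/eqP; rewrite eqEsubset sD.
  by rewrite mul1r.
have /card_gt0P[x] : (0 < #|D1 :\: D0|)%N by rewrite Em.
rewrite inE => /andP[xD0 xD1].
have sxD : x |: D0 \subset D1 by rewrite subUset sub1set xD1.
have Em' : #|D1 :\: (x |: D0)| = m.
  rewrite setUC -setDDl; apply: succn_inj.
  by rewrite -Em [in RHS](cardsD1 x) inE xD0 xD1.
rewrite exprSr -mulrA; apply: (@le_trans _ _ (c ^+ m * #|extends Inv (x |: D0)|%:R)).
  apply: ler_wpM2l; first exact: exprn_ge0.
  by apply: greedy_step => // f; apply: step.
apply: IH => // D y f sDD; apply: step.
by apply: subset_trans sDD; apply: subsetUr.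
Qed.

End Greedy.

(** * Dependent random choice *)

Section DependentRandomChoice.
Variables (R : realFieldType) (G : sgraph).

Definition common (S : {set G}) : {set G} :=
  [set y | [forall x in S, adj x y]].

Lemma commonS (S T : {set G}) : S \subset T -> common T \subset common S.
Proof.
move=> /subsetP ST; apply/subsetP => y; rewrite !inE => /forall_inP Ty.
by apply/forall_inP => x /ST; apply: Ty.
Qed.

(** Both sides say that every entry of [s] is adjacent to every entry of [t]. *)
Lemma all_common (k l : nat) (s : k.-tuple G) (t : l.-tuple G) :
  all [in common [set x in s]] t = all [in common [set x in t]] s.
Proof.
apply/allP/allP => st x xs; rewrite inE; apply/forall_inP => y; rewrite inE => yt.
  by have := st _ yt; rewrite inE adj_sym => /forall_inP; apply; rewrite inE.
by have := st _ yt; rewrite inE adj_sym => /forall_inP; apply; rewrite inE.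
Qed.

(* Tuples rather than sets are counted, so repeated vertices are allowed and
   [S] may meet the tuple. *)
Definition bad_extensions (theta : R) (U : {set G}) (k : nat) (S : {set G}) : nat :=
  \sum_(t : k.-tuple G)
    (all [in U] t && (#|common (S :|: [set x in t])|%:R < theta)%R).

Lemma bad_extensions0 (theta : R) (U S : {set G}) :
  bad_extensions theta U 0 S = (#|common S|%:R < theta)%R :> nat.
Proof.
rewrite /bad_extensions (eq_bigr (fun=> nat_of_bool (#|common S|%:R < theta))).
  by rewrite sum_nat_const card_tuple expn0 mul1n.
move=> t _; rewrite tuple0 /=; congr (nat_of_bool (#|common _|%:R < theta)).
by apply/setP => y; rewrite !inE orbF.
Qed.

Lemma bad_extensionsS (theta : R) (U S : {set G}) (k : nat) :
  bad_extensions theta U k.+1 S =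
  (\sum_(u in U) bad_extensions theta U k (u |: S))%N.
Proof.
rewrite /bad_extensions big_tuple_cons [RHS]big_mkcond.
apply: eq_bigr => u _ /=; case: ifP => uU; last by rewrite big1.
apply: eq_bigr => t _ /=; congr (nat_of_bool (_ && (#|common _|%:R < _)%R)).
by apply/setP => y; rewrite !inE orbCA orbA.
Qed.

(** Double counting: [v] is a common neighbour of [T] exactly when all entries of [T] are neighbours
    of [v]. *)
Lemma sum_card_common (k : nat) :
  (\sum_(T : k.-tuple G) #|common [set x in T]| = \sum_(v : G) degree v ^ k)%N.
Proof.
transitivity (\sum_(T : k.-tuple G) \sum_(v : G) (v \in common [set x in T]))%N.
  by apply: eq_bigr => T _; rewrite -sum1_card big_mkcond.
rewrite exchange_big; apply: eq_bigr => v _.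
rewrite -sum_tuple_all; apply: eq_bigr => T _.
rewrite inE; case: forall_inP => [Tv|Tv].
  suff -> : all [in [set y | adj v y]] T by [].
  by apply/allP => x xT; rewrite inE adj_sym; apply: Tv; rewrite inE.
suff /negPf -> : ~~ all [in [set y | adj v y]] T by [].
apply/negP => /allP vT; apply: Tv => x; rewrite inE => /vT.
by rewrite inE adj_sym.
Qed.

(* A bad tuple [t] lies in [common T] exactly when [T] lies in [common t]. *)
Lemma sum_bad_extensions (theta : R) (k : nat) : 0 <= theta ->
  (\sum_(T : k.-tuple G) bad_extensions theta (common [set x in T]) k set0)%:R
    <= (#|G| ^ k)%:R * theta ^+ k.
Proof.
move=> th0; rewrite /bad_extensions exchange_big natr_sum.
rewrite -card_tuple mulr_natl -sumr_const; apply: ler_sum => t _.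
under eq_bigr => T _ do rewrite set0U all_common -mulnb.
rewrite -big_distrl /= sum_tuple_all.
case: ltP => [lt|_]; last by rewrite muln0 exprn_ge0.
by rewrite muln1 natrX lerXn2r ?nnegrE // ltW.
Qed.

Lemma ex_ge_average (I : finType) (f : I -> R) (c : R) :
  (0 < #|I|)%N -> #|I|%:R * c <= \sum_i f i -> exists i, c <= f i.
Proof.
move=> /card_gt0P[i0 _] le; apply/existsP; apply: contraLR le.
rewrite negb_exists -ltNge => /forallP lt.
rewrite mulr_natl -sumr_const; apply: ltr_sum => [|i _]; last by rewrite ltNge lt.
by apply/hasP; exists i0; rewrite ?mem_index_enum.
Qed.

(** Averaging the size term minus the weighted bad count over all tuples [T] lets one choice of [T]
    control both. *)
Lemma dependent_random_choice (k : nat) (D theta lambda : R) :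
  (0 < #|G|)%N -> 0 <= D -> 0 <= theta -> 0 <= lambda ->
  #|G|%:R * D <= (\sum_(v : G) degree v)%:R ->
  exists U : {set G},
    (#|G|%:R * (D / #|G|%:R) ^+ k.+1) ^+ k.+1 - (lambda * theta) ^+ k.+1
      <= #|U|%:R ^+ k.+1
         - lambda ^+ k.+1 * (bad_extensions theta U k.+1 set0)%:R.
Proof.
move=> G0 D0 th0 l0 leD; set N : R := #|G|%:R; set M := N * (D / N) ^+ k.+1.
have N0 : 0 < N by rewrite ltr0n.
have M0 : 0 <= M by rewrite mulr_ge0 ?exprn_ge0 ?divr_ge0 // ltW.
have I0 : (0 < #|{: k.+1.-tuple G}|)%N by rewrite card_tuple expn_gt0 G0.
pose f (T : k.+1.-tuple G) : R := #|common [set x in T]|%:R ^+ k.+1 -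
  lambda ^+ k.+1 * (bad_extensions theta (common [set x in T]) k.+1 set0)%:R.
have [|T leT] := @ex_ge_average _ f (M ^+ k.+1 - (lambda * theta) ^+ k.+1) I0;
  last by exists (common [set x in T]).
rewrite big_split /= mulrBr; apply: lerD.
  (* Convexity is used twice: here for the sizes of the common neighbourhoods, then for the
     degrees. *)
  apply: power_mean => //.
  rewrite -natr_sum sum_card_common natr_sum card_tuple natrX -/N.
  have -> : N ^+ k.+1 * M = N * D ^+ k.+1.
    by rewrite /M expr_div_n mulrCA [N ^+ _ * _]mulrC divfK ?expf_neq0 ?gt_eqF.
  under eq_bigr => v _ do rewrite natrX.
  by apply: power_mean => //; rewrite -natr_sum.
rewrite sumrN -mulr_sumr lerN2 exprMn mulrCA ler_wpM2l ?exprn_ge0 //.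
by rewrite card_tuple -natr_sum sum_bad_extensions.
Qed.
End DependentRandomChoice.

(** * Union bound and handshake inequality *)

Lemma card_bigcup_le (I T : finType) (P : pred I) (F : I -> {set T}) :
  (#|\bigcup_(i | P i) F i| <= \sum_(i | P i) #|F i|)%N.
Proof.
apply: (big_ind2 (fun (A : {set T}) m => #|A| <= m)%N) => [|A m B p Am Bp|//].
  by rewrite cards0.
by rewrite (leq_trans (leq_card_setU A B)) // leq_add.
Qed.

(** The fibre of adjacent ordered pairs over an edge contains both orientations, distinct by
    irreflexivity. *)
Lemma sum_degree_ge (G : sgraph) :
  (2 * #|edges G| <= \sum_(x : G) degree x)%N.
Proof.
have -> : (\sum_(x : G) degree x =
    \sum_(p : G * G | adj p.1 p.2) 1)%N.
  rewrite -(pair_big_dep xpredT (fun x y : G => adj x y) (fun _ _ => 1%N)) /=.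
  by apply: eq_bigr => x _; rewrite sum1dep_card.
rewrite (partition_big (fun p : G * G => [set p.1; p.2]) [in edges G]) /=.
  rewrite mulnC -sum_nat_const; apply: leq_sum => e.
  rewrite inE => /existsP[x /existsP[y /andP[xy /eqP ->]]].
  rewrite sum1dep_card.
  have neq : (x, y) != (y, x).
    by apply/eqP => -[yx _]; rewrite yx adj_irr in xy.
  have <- : #|[set (x, y); (y, x)]| = 2%N by rewrite cards2 neq.
  apply/subset_leq_card/subsetP => p; rewrite !inE.
  by case/orP => /eqP -> /=; rewrite ?eqxx ?xy //= adj_sym xy setUC eqxx.
move=> [x y] /= xy; rewrite inE; apply/existsP; exists x.
by apply/existsP; exists y; rewrite xy eqxx.
Qed.

(** * Embedding the two sides of [H] *)

Section Embedding.
Variables (R : realFieldType) (H G : sgraph) (theta : R) (U : {set G}).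

Definition nbhd (x : H) : {set H} := [set y | adj x y].

(** Markov's inequality: each vertex of the set accounts for at least [#|U| ^ k / L ^ k] bad tuples,
    so too many of them would exceed the total for [k.+1]. *)
Lemma card_bad_vertices (L k : nat) (S : {set G}) : (0 < #|U|)%N ->
  (L ^ k.+1 * bad_extensions theta U k.+1 S < #|U| ^ k.+1)%N ->
  (L * #|[set u in U | #|U| ^ k <= L ^ k * bad_extensions theta U k (u |: S)]|
    <= #|U|)%N.
Proof.
move=> U0; rewrite bad_extensionsS => lt; set B := [set u in U | _].
have le : (#|B| * #|U| ^ k <=
    L ^ k * \sum_(u in U) bad_extensions theta U k (u |: S))%N.
  rewrite -sum_nat_const big_distrr /=.
  apply: (@leq_trans (\sum_(u in B) L ^ k * bad_extensions theta U k (u |: S))%N).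
    by apply: leq_sum => u; rewrite inE => /andP[].
  rewrite [in X in (_ <= X)%N](big_setID B) /=.
  have -> : U :&: B = B by apply/setIidPr/subsetP => u; rewrite inE => /andP[].
  exact: leq_addr.
have U0k : (0 < #|U| ^ k)%N by rewrite expn_gt0 U0.
rewrite -(leq_pmul2r U0k) -expnS ltnW //; apply: leq_ltn_trans lt.
by rewrite -mulnA expnS -mulnA leq_mul2l le orbT.
Qed.

(** If [S] has fewer than [theta] common neighbours, so has every superset, and all [#|U| ^ k]
    tuples are bad. The case [k > 0] serves vertices of degree below [d]. *)
Lemma few_bad_extensions (L k : nat) (S : {set G}) : (0 < L)%N ->
  (L ^ k * bad_extensions theta U k S < #|U| ^ k)%N ->
  theta <= #|common S|%:R.
Proof.
move=> L0; rewrite leNgt; apply: contraL => lt; rewrite -leqNgt.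
suff -> : bad_extensions theta U k S = (#|U| ^ k)%N.
  by rewrite leq_pmull // expn_gt0 L0.
rewrite -sum_tuple_all; apply: eq_bigr => t _.
suff -> : (#|common (S :|: [set x in t])|%:R < theta)%R by rewrite andbT.
by apply: le_lt_trans lt; rewrite ler_nat subset_leq_card ?commonS ?subsetUl.
Qed.

(** Missing vertices are counted up to [d], not up to the degree of [b], so that every [b] starts
    from the same condition on [set0]. The cardinality clause encodes injectivity on [D]. *)
Definition good_first_side (A : {set H}) (d : nat) (D : {set H}) (f : {ffun H -> G}) :=
  [&& f @: D \subset U, #|f @: D| == #|D| &
    [forall b, (b \notin A) ==>
      let k := (d - #|nbhd b :&: D|)%N in
      ((4 * d) ^ k * bad_extensions theta U k (f @: (nbhd b :&: D)) < #|U| ^ k)%N]].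

Definition good_second_side (A D : {set H}) (f : {ffun H -> G}) :=
  [&& #|f @: D| == #|D|,
    [forall x in D, forall y in D, adj x y ==> adj (f x) (f y)] &
    [forall b, (b \notin A) ==> (theta <= #|common (f @: nbhd b)|%:R)]].

Lemma card_update (D : {set H}) (x : H) (f : {ffun H -> G}) (u : G) :
  x \notin D -> u \notin f @: D -> #|f @: D| = #|D| ->
  #|update f x u @: (x |: D)| = #|x |: D|.
Proof. by move=> xD uD E; rewrite update_imsetU // !cardsU1 xD uD E. Qed.

Variables (A : {set H}) (d : nat).
Hypothesis bipA : forall x y : H, adj x y -> (x \in A) != (y \in A).
Hypothesis degH : forall x : H, (#|nbhd x| <= d)%N.

Lemma nbhd_subset (b : H) : b \notin A -> nbhd b \subset A.
Proof.
move=> bA; apply/subsetP => y; rewrite inE => /bipA.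
by rewrite (negPf bA); case: (y \in A).
Qed.

(** Used values occupy at most a quarter of [U]. Each of the at most [d] neighbours of [x] excludes
    at most [#|U| / (4d)] vertices, together another quarter. *)
Lemma first_side_step (D : {set H}) (x : H) (f : {ffun H -> G}) :
  (0 < d)%N -> (0 < #|U|)%N -> (4 * #|D| <= #|U|)%N ->
  x |: D \subset A -> x \notin D -> good_first_side A d D f ->
  (#|U| <= 2 * #|[set u | good_first_side A d (x |: D) (update f x u)]|)%N.
Proof.
move=> d0 U0 DU xDA xD /and3P[fDU /eqP fD /forallP fb].
have xA : x \in A by apply: (subsetP xDA); rewrite setU11.
pose k b := (d - #|nbhd b :&: D|).-1.
pose B b := [set u in U | #|U| ^ k b <=
  (4 * d) ^ k b * bad_extensions theta U (k b) (u |: f @: (nbhd b :&: D))]%N.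
have nbx b : b \in nbhd x -> b \notin A.
  by rewrite inE => /bipA; rewrite xA eq_sym; case: (b \in A).
have nbI b : b \in nbhd x -> nbhd b :&: (x |: D) = x |: (nbhd b :&: D).
  rewrite inE adj_sym => bx; apply/setP => y; rewrite !inE.
  by case: eqP => // ->; rewrite bx.
have xI b : x \notin nbhd b :&: D by rewrite !inE (negPf xD) andbF.
(* As [x] is a neighbour of [b] outside [D], a vertex is still missing and the predecessor in [k]
   does not truncate. *)
have kS b : b \in nbhd x -> (d - #|nbhd b :&: D|)%N = (k b).+1.
  move=> bx; rewrite /k prednK // subn_gt0.
  apply: leq_trans (degH b); apply/proper_card/properP.
  by split; [apply: subsetIl | exists x => //; rewrite inE adj_sym -inE].
have cardB : (4 * #|\bigcup_(b in nbhd x) B b| <= #|U|)%N.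
  rewrite -(leq_pmul2l d0) mulnA (mulnC d).
  apply: (@leq_trans (\sum_(b in nbhd x) #|U|)%N); last first.
    by rewrite sum_nat_const leq_mul2r degH orbT.
  apply: (@leq_trans (4 * d * \sum_(b in nbhd x) #|B b|)%N).
    by rewrite leq_mul2l card_bigcup_le orbT.
  rewrite big_distrr /=; apply: leq_sum => b bx.
  apply: card_bad_vertices => //; rewrite -kS //.
  by have := fb b; rewrite nbx.
set Z := f @: D :|: \bigcup_(b in nbhd x) B b.
have cardZ : (2 * #|Z| <= #|U|)%N.
  have := leq_card_setU (f @: D) (\bigcup_(b in nbhd x) B b).
  by rewrite -/Z fD => /= -[le _]; lia.
have sub : U :\: Z \subset
    [set u | good_first_side A d (x |: D) (update f x u)].
  apply/subsetP => u; rewrite !inE negb_or => /andP[/andP[uD uB] uU].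
  apply/and3P; split.
  - by rewrite update_imsetU // subUset sub1set uU.
  - by rewrite card_update.
  - apply/forallP => b; apply/implyP => bA /=.
    have [bx|bx] := boolP (b \in nbhd x).
      rewrite nbI // update_imsetU // cardsU1 xI add1n subnS kS //=.
      have uBb : u \notin B b by apply: contra uB => uBb; apply/bigcupP; exists b.
      by move: uBb; rewrite inE uU /= -ltnNge.
    have -> : nbhd b :&: (x |: D) = nbhd b :&: D.
      apply/setP => y; rewrite !inE; case: eqP => // ->.
      by move: bx; rewrite inE adj_sym => /negPf ->.
    by rewrite update_imset //; have := fb b; rewrite bA.
have := subset_leq_card sub; rewrite cardsD.
have := subset_leq_card (subsetIr U Z); lia.
Qed.

Lemma second_side_step (D : {set H}) (x : H) (f : {ffun H -> G}) :
  A \subset D -> x \notin D -> good_second_side A D f ->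
  theta - #|D|%:R <=
    #|[set u | good_second_side A (x |: D) (update f x u)]|%:R.
Proof.
move=> AD xD /and3P[/eqP fD /forall_inP fadj /forallP fb].
have xA : x \notin A by apply: contra xD; apply: (subsetP AD).
set Z := common (f @: nbhd x) :\: f @: D.
have sub : Z \subset [set u | good_second_side A (x |: D) (update f x u)].
  apply/subsetP => u; rewrite !inE => /andP[uD /forall_inP ux].
  have adjx y : y \in D -> adj x y -> adj (f y) u.
    by move=> yD xy; apply: ux; apply: imset_f; rewrite inE.
  apply/and3P; split.
  - by rewrite card_update.
  - apply/forall_inP => y yD; apply/forall_inP => z zD; apply/implyP => yz.
    move: yD zD; rewrite !ffunE !inE.
    case: eqP => [yx|_] /=; case: eqP => [zx|_] //= yD zD.
    + by rewrite yx zx adj_irr in yz.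
    + by rewrite adj_sym; apply: adjx => //; rewrite -yx.
    + by apply: adjx => //; rewrite adj_sym -zx.
    + by have /forall_inP/(_ z zD)/implyP := fadj y yD; apply.
  - apply/forallP => b; apply/implyP => bA.
    rewrite update_imset; first by have := fb b; rewrite bA.
    by apply: contra xA; apply: (subsetP (nbhd_subset bA)).
have := fb x; rewrite xA /= => le.
rewrite lerBlDr -natrD (le_trans le) // ler_nat.
have := subset_leq_card sub; rewrite cardsD.
have := subset_leq_card (subsetIr (common (f @: nbhd x)) (f @: D)).
rewrite fD; lia.
Qed.

(** [A] spans no edge, so adjacency is vacuous, and the neighbourhood of each vertex outside [A] is
    fully embedded. *)
Lemma good_first_to_second (f : {ffun H -> G}) :
  (0 < d)%N -> good_first_side A d A f -> good_second_side A A f.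
Proof.
move=> d0 /and3P[_ fA /forallP fb]; apply/and3P; split=> //.
  apply/forall_inP => x xA; apply/forall_inP => y yA; apply/implyP => /bipA.
  by rewrite xA yA.
apply/forallP => b; apply/implyP => bA; have := fb b; rewrite bA /=.
rewrite (setIidPl (nbhd_subset bA)); apply: few_bad_extensions.
by rewrite muln_gt0.
Qed.

End Embedding.

Lemma many_labeled_copies (R : realFieldType) (H G : sgraph) (A : {set H}) (d : nat)
    (theta : R) (U : {set G}) :
  (forall x y : H, adj x y -> (x \in A) != (y \in A)) ->
  (forall x : H, (degree x <= d)%N) -> (0 < d)%N -> (0 < #|U|)%N ->
  (4 * #|H| <= #|U|)%N -> #|H|%:R <= theta ->
  ((4 * d) ^ d * bad_extensions theta U d set0 < #|U| ^ d)%N ->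
  (#|U|%:R / 2) ^+ #|A| * (theta - #|H|%:R) ^+ #|~: A|
    <= #|labeled_copies H G|%:R.
Proof.
move=> bipA degH d0 U0 HU Hth goodU.
have [u0 _] := card_gt0P U0.
(* Both stages share this default, so the final maps of the first can start the second. *)
pose f0 : {ffun H -> G} := [ffun=> u0].
(* On the empty domain the invariant reduces to the hypothesis on bad [d]-tuples. *)
have start : (0 < #|extends f0 (good_first_side theta U A d) set0|)%N.
  apply/card_gt0P; exists f0; rewrite inE; apply/andP; split; last first.
    by apply/forallP => y; rewrite eqxx implybT.
  apply/and3P; split; rewrite ?imset0 ?sub0set ?cards0 //.
  by apply/forallP => b; apply/implyP => _; rewrite setI0 imset0 cards0 subn0.
have first : (#|U|%:R / 2) ^+ #|A| <=
    #|extends f0 (good_first_side theta U A d) A|%:R :> R.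
  have /(@greedy _ _ f0 R (good_first_side theta U A d) set0 A) :
    0 <= #|U|%:R / 2 :> R by rewrite divr_ge0.
  rewrite sub0set setD0 => /(_ isT) le.
  apply: (@le_trans _ _ ((#|U|%:R / 2) ^+ #|A| *
      #|extends f0 (good_first_side theta U A d) set0|%:R)).
    by rewrite ler_peMr ?ler1n // exprn_ge0 ?divr_ge0.
  apply: le => D x f _ sD xD fD.
  rewrite ler_pdivrMr // -natrM ler_nat mulnC.
  apply: first_side_step => //.
  by apply: leq_trans HU; rewrite leq_mul2l max_card orbT.
have second : (theta - #|H|%:R) ^+ #|~: A| *
    #|extends f0 (good_second_side theta A) A|%:R <=
    #|extends f0 (good_second_side theta A) [set: H]|%:R.
  rewrite -setTD; apply: greedy; rewrite ?subsetT ?subr_ge0 //.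
  move=> D x f AD _ xD fD; apply: le_trans (second_side_step bipA AD xD fD).
  by rewrite lerD2l lerN2 ler_nat max_card.
have le12 : (#|extends f0 (good_first_side theta U A d) A| <=
    #|extends f0 (good_second_side theta A) A|)%N.
  apply/subset_leq_card/subsetP => f; rewrite !inE => /andP[fA ->].
  by rewrite andbT; apply: good_first_to_second fA.
have final : (#|extends f0 (good_second_side theta A) [set: H]| <=
    #|labeled_copies H G|)%N.
  apply/subset_leq_card/subsetP => f; rewrite !inE => /andP[/and3P[fI fadj _] _].
  apply/andP; split.
    by apply/injectiveP => x y; apply: (imset_injP fI); rewrite inE.
  apply/forallP => x; apply/forallP => y.
  by have /forall_inP/(_ y (in_setT y)) := forall_inP fadj x (in_setT x).
apply: le_trans (_ : _ <= #|extends f0 (good_second_side theta A) [set: H]|%:R) _;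
  last by rewrite ler_nat.
apply: le_trans second; rewrite mulrC ler_wpM2l ?exprn_ge0 ?subr_ge0 //.
by apply: le_trans first _; rewrite ler_nat.
Qed.

(** * Choice of parameters and final estimate *)

Lemma bipartite_large_side (H : sgraph) : bipartite H ->
  exists2 A : {set H}, (#|~: A| <= #|A|)%N &
    forall x y : H, adj x y -> (x \in A) != (y \in A).
Proof.
move=> [A bipA]; have [le|/ltnW lt] := leqP #|~: A| #|A|; first by exists A.
exists (~: A) => [|x y /bipA]; first by rewrite setCK.
by rewrite !inE; case: (x \in A); case: (y \in A).
Qed.

(** After squaring, [b] pairs of factors match exactly, since [8 * 16d = 128d]; the [a - b]
    remaining factors satisfy [64 <= 128d]. This is why the larger side must get the factor 8. *)
Lemma powR_sides_le (R : realType) (a b d : nat) : (0 < d)%N -> (b <= a)%N ->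
  (8 ^+ a * (16 * d%:R) ^+ b : R) <=
    ((2 ^ 7 * d)%:R : R) `^ ((a + b)%:R / 2%:R).
Proof.
move=> d0 ba; set K : R := (_ * _)%:R.
have K0 : 0 <= K by rewrite ler0n.
have d1 : 1 <= d%:R :> R by rewrite ler1n.
have EK : K = 128 * d%:R by rewrite /K natrM natrX; congr (_ * _); lra.
rewrite -(@ler_pXn2r _ 2) ?nnegrE ?powR_ge0 ?mulr_ge0 ?exprn_ge0 ?mulr_ge0 //.
rewrite -[X in _ <= X]powR_mulrn ?powR_ge0 // -powRrM divfK ?pnatr_eq0 //.
rewrite powR_mulrn // EK.
rewrite exprMn -!exprM ![(_ * 2)%N]mulnC !exprM -(subnK ba).
set c := (a - b)%N.
have -> : 8 ^+ 2 = 64 :> R by lra.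
have -> : (128 * d%:R) ^+ (c + b + b) = (128 * d%:R) ^+ c * ((128 * d%:R) ^+ 2) ^+ b :> R.
  by rewrite -addnA exprD addnn -mul2n exprM.
rewrite exprD -mulrA -exprMn.
have -> : 64 * (16 * d%:R) ^+ 2 = (128 * d%:R) ^+ 2 :> R by ring.
rewrite ler_wpM2r ?exprn_ge0 ?mulr_ge0 // lerXn2r ?nnegrE //; lra.
Qed.

Lemma sum_degree_le (G : sgraph) :
  (\sum_(x : G) degree x <= #|G| * #|G|.-1)%N.
Proof.
rewrite -sum_nat_const; apply: leq_sum => x _.
rewrite -(cardsC1 x); apply/subset_leq_card/subsetP => y; rewrite !inE.
by case: eqP => // ->; rewrite adj_irr.
Qed.

(** Dependent random choice is applied with [lambda = 4d], so that [lambda * theta = q / 2]. The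
    resulting difference is at least [(q / 4) ^ d], and its positivity bounds the bad tuples. *)
Lemma rich_subset (R : realFieldType) (G : sgraph) (d : nat) (eps : R) :
  let q := eps ^+ d * #|G|%:R in
  (0 < d)%N -> (2 <= #|G|)%N -> 0 < eps ->
  32 * d%:R * eps ^- d <= #|G|%:R ->
  eps * 'C(#|G|, 2)%:R <= #|edges G|%:R ->
  exists U : {set G}, q / 4 <= #|U|%:R /\
    ((4 * d) ^ d * bad_extensions (q / (8 * d%:R)) U d set0 < #|U| ^ d)%N.
Proof.
move=> q d0 N2 eps0 Nd dense.
set N : R := #|G|%:R.
have N0 : 0 < N by rewrite ltr0n; apply: leq_trans N2.
have N2R : 2 <= N by rewrite ler_nat.
have q0 : 0 < q by rewrite mulr_gt0 ?exprn_gt0.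
have d1 : 1 <= d%:R :> R by rewrite ler1n.
have predN : #|G|.-1%:R = N - 1 :> R by rewrite -subn1 natrB // (leq_trans _ N2).
have degsum : N * (eps * (N - 1)) <= (\sum_(v : G) degree v)%:R.
  apply: (@le_trans _ _ (2 * #|edges G|)%:R); last by rewrite ler_nat sum_degree_ge.
  have <- : 2 * (eps * 'C(#|G|, 2)%:R) = N * (eps * (N - 1)) :> R.
    rewrite mulrCA -natrM -[X in (X * _)%N]/(2`!) mulnC bin_ffact ffactnS ffactn1.
    by rewrite natrM predN mulrCA.
  by rewrite natrM ler_pM2l.
(* The degree sum is at most [N * (N - 1)]. Hence [eps ^- d >= 1], which turns the hypothesis into
   [32d <= N]. *)
have eps1 : eps <= 1.
  have : N * (eps * (N - 1)) <= N * (N - 1).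
    by apply: le_trans degsum _; rewrite -predN -natrM ler_nat sum_degree_le.
  rewrite ler_pM2l // ger_pMl //; lra.
have dN : 32 * d%:R <= N.
  apply: le_trans Nd; rewrite ler_peMr ?mulr_ge0 //.
  by rewrite invf_ge1 ?exprn_gt0 // exprn_ile1 // ltW.
case: d => [//|k] in q d0 Nd q0 d1 dN *.
have D0 : 0 <= eps * (N - 1) by rewrite mulr_ge0 ?(ltW eps0) //; lra.
have th0 : 0 <= q / (8 * k.+1%:R) by apply: divr_ge0; [apply: ltW | rewrite mulr_ge0].
have l0 : 0 <= (4 * k.+1)%:R :> R by [].
have G0 : (0 < #|G|)%N by apply: leq_trans N2.
have [U leU] := @dependent_random_choice R G k _ _ _ G0 D0 th0 l0 degsum.
exists U; move: leU; rewrite -/N; set M := N * _; set bad := bad_extensions _ _ _ _.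
have -> : (4 * k.+1)%:R * (q / (8 * k.+1%:R)) = q / 2.
  by rewrite natrM; field; rewrite nat1r pnatr_eq0.
(* The average degree involves [N - 1] instead of [N]; Bernoulli's inequality, the tangent at 1,
   bounds the loss by [1 - d / N >= 31 / 32]. *)
have leM : q * 31 / 32 <= M.
  have -> : M = q * (1 - N^-1) ^+ k.+1.
    rewrite /M; have -> : eps * (N - 1) / N = eps * (1 - N^-1) by field; lra.
    by rewrite exprMn mulrA [N * _]mulrC.
  rewrite -mulrA ler_pM2l //.
  have x0 : 0 <= 1 - N^-1 by rewrite subr_ge0 invf_le1 //; lra.
  have := @expr_tangent R _ 1 k x0 ler01.
  rewrite !expr1n; apply: le_trans.
  have : k.+1%:R / N <= 1 / 32 by rewrite ler_pdivrMr //; lra.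
  lra.
(* Superadditivity of the power reduces this to [3q / 4 <= M]. *)
have lb : (q / 4) ^+ k.+1 <= M ^+ k.+1 - (q / 2) ^+ k.+1.
  rewrite lerBrDr; apply: le_trans (_ : _ <= (q / 4 + q / 2) ^+ k.+1) _.
    by apply: ler_exprD; lra.
  by apply: lerXn2r; rewrite ?nnegrE; lra.
move=> /(le_trans lb) le; split.
  rewrite -(@ler_pXn2r _ k.+1) ?nnegrE //; last lra.
  by apply: le_trans le _; rewrite gerBl mulr_ge0 ?exprn_ge0.
rewrite -(ltr_nat R) natrM !natrX -subr_gt0; apply: lt_le_trans le.
by rewrite exprn_gt0 //; lra.
Qed.

Theorem theorem1p6 (R : realType) (H G : sgraph) (n d N : nat) (eps : R)
    (Hn : #|H| = n) (Hd : max_degree H = d) (d_ge1 : (1 <= d)%N)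
    (Hbip : bipartite H) (eps_gt0 : 0 < eps)
    (HN : #|G| = N) (N_ge2 : (2 <= N)%N)
    (N_ge : 32%:R * d%:R * eps ^- d * n%:R <= N%:R)
    (Gdense : eps * 'C(N, 2)%:R <= #|edges G|%:R) :
  ((2 ^ 7 * d)%:R : R) `^ (- (n%:R / 2%:R)) * eps ^+ (d * n) * N%:R ^+ n
    <= #|labeled_copies H G|%:R.
Proof.
have degH (x : H) : (degree x <= d)%N by rewrite -Hd; apply: leq_bigmax.
(* The maximum degree of an empty graph is 0. *)
have n0 : (0 < n)%N.
  rewrite lt0n; apply: contraTneq d_ge1 => n0; rewrite -leqNgt -Hd.
  apply/bigmax_leqP => x _; have := fintype0 x; rewrite Hn n0; exact.
have [A sideA bipA] := bipartite_large_side Hbip.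
subst N n; clear Hd; set q : R := eps ^+ d * #|G|%:R.
have d1 : 1 <= d%:R :> R by rewrite ler1n.
have n1 : 1 <= #|H|%:R :> R by rewrite ler1n.
have epsd : 0 < eps ^+ d by rewrite exprn_gt0.
have nq : 32 * d%:R * #|H|%:R <= q.
  by move: N_ge; rewrite mulrAC ler_pdivrMr // [X in _ <= X]mulrC.
have dN : 32 * d%:R * eps ^- d <= #|G|%:R.
  apply: le_trans N_ge; rewrite ler_peMr // mulr_ge0 ?invr_ge0 ?(ltW epsd) //; lra.
have [U [leU badU]] := @rich_subset R G d eps d_ge1 N_ge2 eps_gt0 dN Gdense.
rewrite -/q in leU badU; set theta := q / (8 * d%:R) in badU.
have q0 : 0 < q by apply: lt_le_trans nq; rewrite !mulr_gt0 ?ltr0n.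
have ndn : #|H|%:R <= d%:R * #|H|%:R :> R by rewrite ler_peMl; lra.
have nth : #|H|%:R <= q / (32 * d%:R) by rewrite ler_pdivlMr; lra.
(* In units of [q / (32d)], [theta] is 4 and [#|H|] is at most 1, so at least 2 remain. *)
have theta_n : q / (16 * d%:R) <= theta - #|H|%:R.
  have -> : q / (16 * d%:R) = 2 * (q / (32 * d%:R)) by field; lra.
  have -> : theta = 4 * (q / (32 * d%:R)) by rewrite /theta; field; lra.
  have : 0 <= q / (32 * d%:R) by rewrite divr_ge0; lra.
  lra.
have HU : (4 * #|H| <= #|U|)%N by rewrite -(ler_nat R) natrM; lra.
have U0 : (0 < #|U|)%N by apply: leq_trans HU; rewrite muln_gt0.
have nth' : #|H|%:R <= theta.
  by rewrite -subr_ge0; apply: le_trans theta_n; rewrite divr_ge0; lra.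
have := @many_labeled_copies R H G A d theta U bipA degH d_ge1 U0.
move=> /(_ HU nth' badU); apply: le_trans.
apply: (@le_trans _ _ ((q / 8) ^+ #|A| * (q / (16 * d%:R)) ^+ #|~: A|)); last first.
  have q8 : 0 <= q / 8 by lra.
  have q16 : 0 <= q / (16 * d%:R) by rewrite divr_ge0; lra.
  apply: ler_pM; rewrite ?exprn_ge0 //; apply: lerXn2r; rewrite ?nnegrE //; lra.
have card_n : (#|A| + #|~: A|)%N = #|H| by rewrite cardsC.
have bound := @powR_sides_le R _ _ d d_ge1 sideA.
rewrite card_n in bound.
(* Collecting [eps ^ (d n) * N ^ n] as [q ^ n] and cancelling it leaves the inverse of [bound]. *)
rewrite -mulrA exprM -exprMn -/q powRN mulrC !expr_div_n mulrACA -exprD card_n.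
rewrite ler_pM2l ?exprn_gt0 // -invfM lef_pV2 // posrE.
  by rewrite powR_gt0 // ltr0n muln_gt0.
by rewrite mulr_gt0 ?exprn_gt0 ?mulr_gt0 ?ltr0n.
Qed.
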